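(* Let $D\ge3$ be a natural number. There exists a stochastic block model $\mathrm{SBM}(n;p,Q)$ on $2$ communities (with $p,Q$ allowed to depend on $n$) with the following property. It can be distinguished from $\mathbb{G}(n,1/2)$ with high probability via the signed count of $\mathrm{Star}_D$, but not via the signed count of any other connected graph with at least one and at most $D$ edges.
   Context: Graphs are finite, simple and undirected. $\mathrm{Star}_D$ is the star with $D$ edges. $\mathbb{G}(n,1/2)$ is the Erdős–Rényi random graph. A stochastic block model on $k$ communities is given by a probability vector $p\in(0,1]^k$ and a symmetric matrix $Q\in[-1,1]^{k\times k}$. A sample $\mathbf{G}\sim\mathrm{SBM}(n;p,Q)$ is an $n$-vertex graph produced by drawing i.i.d. labels $\mathbf{x}_1,\dots,\mathbf{x}_n\in[k]$ with pmf $p$, and then including each edge $(i,j)$ independently with probability $(1+Q_{\mathbf{x}_i,\mathbf{x}_j})/2$. The signed count of $H$ in an $n$-vertex graph $G$ with edge indicators $G_{ij}$ is $\mathrm{SC}_H(G)=\sum_{H_1\sim H}\prod_{(i,j)\in E(H_1)}(2G_{ij}-1)$, the sum over all subgraphs $H_1$ of $K_n$ isomorphic to $H$. With $f=\mathrm{SC}_H$ and $M_n=\max(\mathrm{Var}_{\mathbb{G}(n,1/2)}[f]^{1/2},\mathrm{Var}_{\mathbb{P}_n}[f]^{1/2})$, the signed count of $H$ distinguishes $\mathbb{P}_n$ from $\mathbb{G}(n,1/2)$ (with high probability) if $|\mathbb{E}_{\mathbb{P}_n}f-\mathbb{E}_{\mathbb{G}(n,1/2)}f|=\omega(M_n)$,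 and it fails to distinguish (''not via'') if $|\mathbb{E}_{\mathbb{P}_n}f-\mathbb{E}_{\mathbb{G}(n,1/2)}f|=o(M_n)$, as $n\to\infty$. *)

(* Defs.v *)
From HB Require Import structures.
From mathcomp Require Import all_boot all_order all_algebra.
From mathcomp Require Import boolp classical_sets reals topology normedtype landau.

Set Implicit Arguments.
Unset Strict Implicit.
Unset Printing Implicit Defensive.

Import Order.TTheory GRing.Theory Num.Theory.
Import numFieldNormedType.Exports.

Local Open Scope ring_scope.

(* A simple graph is given by its edge set, the edges being two-element sets. *)
Record sgraph (V : finType) := SGraph {
  edges : {set {set V}};
  _ : [forall e in edges, #|e| == 2%N] }.

HB.instance Definition _ (V : finType) := [isSub for @edges V].
HB.instance Definition _ (V : finType) := [Finite of sgraph V by <:].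

Definition adj (V : finType) (G : sgraph V) : rel V :=
  [rel x y | [set x; y]%SET \in edges G].

Definition connected_graph (V : finType) (G : sgraph V) : Prop :=
  (0 < #|V|)%N /\ forall x y : V, connect (adj G) x y.

Definition graph_iso (V W : finType) (G : sgraph V) (H : sgraph W) : Prop :=
  exists2 f : V -> W, bijective f & forall x y, adj H (f x) (f y) = adj G x y.

Definition star_edges (D : nat) : {set {set 'I_D.+1}} :=
  [set [set ord0; lift ord0 i] | i : 'I_D]%SET.

Lemma star_edgesP (D : nat) : [forall e in star_edges D, #|e| == 2%N].
Proof.
by apply/forall_inP => _ /imsetP[i _ ->]; rewrite cards2.
Qed.

Definition star (D : nat) : sgraph 'I_D.+1 := SGraph (star_edgesP D).

(* Subgraphs of K_n, as pairs (vertex set, edge set). *)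
Definition is_subgraph (n : nat) (S : {set 'I_n} * {set {set 'I_n}}) : bool :=
  [forall e in S.2, (e \subset S.1) && (#|e| == 2%N)].

Definition subgraph_iso (n : nat) (V : finType) (H : sgraph V)
    (S : {set 'I_n} * {set {set 'I_n}}) : bool :=
  [exists f : {ffun V -> 'I_n},
    [&& injectiveb f, f @: [set: V]%SET == S.1 &
        [forall x, forall y, ([set f x; f y]%SET \in S.2) == adj H x y]]].

Section RandomGraphs.
Variable R : realType.

Definition signed_count (V : finType) (H : sgraph V) (n : nat)
    (G : sgraph 'I_n) : R :=
  \sum_(S : {set 'I_n} * {set {set 'I_n}} | is_subgraph S && subgraph_iso H S)
    \prod_(e in S.2) (2 * (e \in edges G)%:R - 1).

(* Each pair i < j is an edge with probability w i j, independently. *)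
Definition indep_edges_pmf (n : nat) (w : 'I_n -> 'I_n -> R)
    (G : sgraph 'I_n) : R :=
  \prod_(i < n) \prod_(j < n | (i < j)%N)
    (if adj G i j then w i j else 1 - w i j).

Definition er_half_pmf (n : nat) : sgraph 'I_n -> R :=
  indep_edges_pmf (fun _ _ => 1 / 2).

Definition sbm_params (k : nat) (p : 'rV[R]_k) (Q : 'M[R]_k) : Prop :=
  [/\ forall a, 0 < p 0 a <= 1,
      \sum_a p 0 a = 1,
      forall a b, Q a b = Q b a &
      forall a b, -1 <= Q a b <= 1].

(* The law of the graph alone: the labels x are summed out. *)
Definition sbm_pmf (n k : nat) (p : 'rV[R]_k) (Q : 'M[R]_k)
    (G : sgraph 'I_n) : R :=
  \sum_(x : {ffun 'I_n -> 'I_k})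
    (\prod_(i < n) p 0 (x i)) *
    indep_edges_pmf (fun i j => (1 + Q (x i) (x j)) / 2) G.

Definition expectation (n : nat) (mu f : sgraph 'I_n -> R) : R :=
  \sum_(G : sgraph 'I_n) mu G * f G.

Definition variance (n : nat) (mu f : sgraph 'I_n -> R) : R :=
  expectation mu (fun G => (f G - expectation mu f) ^+ 2).

Definition sc_gap (P : forall n, sgraph 'I_n -> R) (V : finType)
    (H : sgraph V) (n : nat) : R :=
  `| expectation (@P n) (@signed_count V H n)
     - expectation (@er_half_pmf n) (@signed_count V H n) |.

Definition sc_scale (P : forall n, sgraph 'I_n -> R) (V : finType)
    (H : sgraph V) (n : nat) : R :=
  Num.max (Num.sqrt (variance (@er_half_pmf n) (@signed_count V H n)))
          (Num.sqrt (variance (@P n) (@signed_count V H n))).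

Local Open Scope classical_set_scope.

(* a = omega(b) is b = o(a). *)
Definition sc_distinguishes (P : forall n, sgraph 'I_n -> R) (V : finType)
    (H : sgraph V) : Prop :=
  sc_scale P H =o_\oo sc_gap P H.

Definition sc_fails (P : forall n, sgraph 'I_n -> R) (V : finType)
    (H : sgraph V) : Prop :=
  sc_gap P H =o_\oo sc_scale P H.

End RandomGraphs.

(* Main.v *)
Require Import Defs.
From mathcomp Require Import boolp classical_sets reals topology normedtype landau exp.
From mathcomp Require Import all_boot all_order all_algebra.
From mathcomp Require Import perm ring lra zify.

Import Order.TTheory GRing.Theory Num.Theory.
Import numFieldNormedType.Exports.
Local Open Scope ring_scope.

Set Implicit Arguments.
Unset Strict Implicit.
Unset Printing Implicit Defensive.

(* The two communities are a rare one, of probability q, and its complement; inside a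
   community edges are unbiased, across they have bias delta.  With t := n^(1/(4D)), take
   delta = t^-(2D-2) and q = t^-(4D-1).  Labels are averaged over vertices, so the mean of the
   signed character of an edge set E is delta^|E| times the probability that every edge of E
   is bichromatic.  A bichromatic colouring of a connected graph with an edge has at least one
   rare vertex, and at least two unless the graph is a star.  Hence a connected H with v
   vertices and e edges has normalised mean at most about n^(v/2) delta^e q if e < D and
   n^(v/2) delta^e q^2 if e = D and H is not a star; as v <= e + 1, both are O(1/t), while
   Star_D has normalised mean of order n^((D+1)/2) delta^D q = t.
   For the variance of the Star_D count only pairs of stars sharing w >= 1 vertices matter,
   by independence.  Such a pair shares at most w - 1 edges, and since n delta^2 >= 1 every
   shared edge costs at most a factor n.  Two distinct stars thus have covariance at most of
   order n^(w-1) q delta^(2D) = n^w (q delta^D)^2 / t, because n q = t, and coinciding stars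
   contribute 1 = n^(D+1) (q delta^D)^2 / t^2. *)

(** * Signed characters *)

Section EdgeCharacters.
Variables (R : realType) (n : nat).
Implicit Types (E F : {set {set 'I_n}}) (G : sgraph 'I_n) (w : {set 'I_n} -> R).

Definition edge_sets E : bool := [forall e in E, #|e| == 2%N].

Definition symdiff (T : finType) (A B : {set T}) : {set T} :=
  (A :\: B) :|: (B :\: A).

Definition chi E G : R := \prod_(e in E) (2 * (e \in edges G)%:R - 1).

Lemma in_symdiff (T : finType) (A B : {set T}) x :
  (x \in symdiff A B) = (x \in A) (+) (x \in B).
Proof. by rewrite !inE; case: (x \in A); case: (x \in B). Qed.

Lemma symdiff_eq0 (T : finType) (A B : {set T}) : (symdiff A B == set0) = (A == B).
Proof.
apply/eqP/eqP => [AB0|->]; last by rewrite /symdiff setDv setU0.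
by apply/setP => x; have := in_symdiff A B x; rewrite AB0 inE; do 2 case: (x \in _).
Qed.

Lemma card_symdiff (T : finType) (A B : {set T}) :
  (#|symdiff A B| + 2 * #|A :&: B| = #|A| + #|B|)%N.
Proof.
rewrite cardsU (_ : _ :&: _ = set0); last first.
  by apply/setP => x; rewrite !inE; do 2 case: (x \in _).
rewrite cards0 subn0 -(cardsID B A) -(cardsID A B) (setIC B A); lia.
Qed.

Lemma edge_sets_symdiff E F : edge_sets E -> edge_sets F -> edge_sets (symdiff E F).
Proof.
move=> /forall_inP hE /forall_inP hF; apply/forall_inP => e.
by rewrite !inE => /orP[/andP[_ /hE]|/andP[_ /hF]].
Qed.

(** Every factor of a character is 1 or -1, so an edge lying in both [E] and [F] squares to 1 and
    drops out. *)
Lemma chiM E F G : chi E G * chi F G = chi (symdiff E F) G.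
Proof.
rewrite /chi !(big_mkcond (fun e => e \in _)) -big_split /=; apply: eq_bigr => e _.
rewrite in_symdiff; case: (e \in E); case: (e \in F); rewrite /= ?mul1r ?mulr1 //.
by case: (e \in edges G) => /=; ring.
Qed.

Lemma sum_sgraph (f : {set {set 'I_n}} -> R) :
  \sum_(G : sgraph 'I_n) f (edges G) = \sum_(E | edge_sets E) f E.
Proof.
rewrite (reindex_omap (@edges 'I_n) insub) /=; last first.
  by move=> E hE; rewrite insubT.
apply: eq_big => [G|//].
by rewrite valK eqxx andbT; case: G.
Qed.

(** Ordered pairs [i < j] correspond bijectively to two-element sets. Indexing by sets puts the law
    and the characters over the same index. *)
Lemma indep_edges_pmfE (w2 : 'I_n -> 'I_n -> R) w G :
  (forall i j, i != j -> w2 i j = w [set i; j]%SET) ->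
  indep_edges_pmf w2 G =
  \prod_(e : {set 'I_n} | #|e| == 2%N) (if e \in edges G then w e else 1 - w e).
Proof.
move=> hw; rewrite /indep_edges_pmf pair_big_dep /=.
rewrite [RHS](eq_bigl (fun e => e \in
  [set [set ij.1; ij.2]%SET | ij in [set ij : 'I_n * 'I_n | (ij.1 < ij.2)%N]])); last first.
  move=> e; apply/idP/imsetP => [/cards2P[i [j [ij ->]]]|[[i j]]].
    case: (ltngtP i j) => [lt|lt|/val_inj eq]; last by rewrite eq eqxx in ij.
      by exists (i, j) => //; rewrite inE.
    by exists (j, i); rewrite ?inE //= setUC.
  by rewrite inE /= => lt ->; rewrite cards2 neq_ltn lt.
rewrite big_imset /=; last first.
  move=> [i j] [k l]; rewrite !inE /= => ij kl e.
  have : i \in [set k; l]%SET by rewrite -e set21.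
  have : j \in [set k; l]%SET by rewrite -e set22.
  rewrite !inE => /orP[]/eqP ? /orP[]/eqP ?; subst => //; try lia.
apply: eq_big => [[i j]|[i j]]; first by rewrite inE.
by move=> /= ij; rewrite hw // neq_ltn ij.
Qed.

Lemma expectation_chi (w2 : 'I_n -> 'I_n -> R) w E :
  (forall i j, i != j -> w2 i j = w [set i; j]%SET) -> edge_sets E ->
  expectation (indep_edges_pmf w2) (chi E) = \prod_(e in E) (2 * w e - 1).
Proof.
move=> hw /forall_inP hE.
(* [a e] and [b e] are what [e] contributes to law times character when it is present or absent.
   Outside two-element sets the values 0 and 1 kill every family containing such a set and leave the
   others unchanged, so the sum may run over all families [J]. *)
pose a (e : {set 'I_n}) : R := if #|e| == 2%N then w e else 0.
pose b (e : {set 'I_n}) : R := if #|e| == 2%N then (1 - w e) * (if e \in E then -1 else 1) else 1.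
rewrite /expectation.
pose f (J : {set {set 'I_n}}) :=
  \prod_(e : {set 'I_n}) (if e \in J then a e else b e).
have -> : \sum_G indep_edges_pmf w2 G * chi E G = \sum_(G : sgraph 'I_n) f (edges G).
  apply: eq_bigr => G _; rewrite (indep_edges_pmfE _ hw) /chi /f.
  rewrite (big_mkcond (fun e : {set 'I_n} => #|e| == _)) (big_mkcond (fun e => e \in E)) -big_split /=.
  apply: eq_bigr => e _; rewrite /a /b; have [e2|e2] := ifPn.
    by case: (e \in edges G); case: (e \in E) => /=; ring.
  rewrite ifN; last by apply: contra e2 => /hE.
  rewrite ifN ?mulr1 //.
  by apply: contra e2; case: (G) => GE /= /forall_inP; apply.
have -> : \sum_(G : sgraph 'I_n) f (edges G) = \sum_J f J.
  rewrite sum_sgraph big_mkcond /=; apply: eq_bigr => J _; case: ifPn => // hJ.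
  case/forall_inPn: hJ => e eJ e2; rewrite /f (bigD1 e) //= eJ /a ifN ?mul0r //.
(* The sum over families now factors into the terms [a e + b e], which equal [2 * w e - 1] on [E]
   and 1 elsewhere. *)
rewrite -bigA_distr /= [RHS]big_mkcond /=; apply: eq_bigr => e _.
rewrite /a /b; case: ifPn => e2; last by rewrite ifN ?add0r //; apply: contra e2 => /hE.
by case: ifP => _; ring.
Qed.

End EdgeCharacters.

(** * Random labels *)

Section Labels.
Variables (R : realType) (q : R).
Hypotheses (q_gt0 : 0 < q) (q_lt1 : q < 1).

Definition two_pmf : 'rV[R]_2 := \row_a (if a == ord0 then q else 1 - q).
Definition cross_mx (delta : R) : 'M[R]_2 :=
  \matrix_(a, b) (if a == b then 0 else delta).

Lemma ord2_neq (a b : 'I_2) : (a != b) = ((a == ord0) (+) (b == ord0)).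
Proof. by case: a b => [[|[|//]] ?] [[|[|//]] ?]. Qed.

Lemma sbm_params_two (delta : R) : 0 <= delta <= 1 -> sbm_params two_pmf (cross_mx delta).
Proof.
move=> /andP[d0 d1]; move: q_gt0 q_lt1 => q0 q1; split.
- by move=> a; rewrite mxE; case: ifP => _; apply/andP; split; lra.
- by rewrite big_ord_recl big_ord1 !mxE /=; lra.
- by move=> a b; rewrite !mxE eq_sym.
- by move=> a b; rewrite !mxE; case: ifP => _; apply/andP; split; lra.
Qed.

Variable n : nat.
Implicit Types (x y : {ffun 'I_n -> 'I_2}) (A : {set 'I_n}) (E F : {set {set 'I_n}}).

Definition weight x : R := \prod_(i < n) two_pmf 0 (x i).

Definition bichromatic x E : bool :=
  [forall e in E, [exists i in e, [exists j in e, x i != x j]]].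

Definition cross_prob E : R := \sum_x weight x * (bichromatic x E)%:R.

Lemma weight_ge0 x : 0 <= weight x.
Proof. by move: q_gt0 q_lt1 => q0 q1; apply: prodr_ge0 => i _; rewrite mxE; case: ifP => _; lra. Qed.

(** The labels are independent, so the sum over labellings distributes over the vertices. *)
Lemma sum_weight_prod (g : 'I_n -> 'I_2 -> R) :
  \sum_x weight x * \prod_i g i (x i) = \prod_i (q * g i ord0 + (1 - q) * g i 1).
Proof.
rewrite (eq_bigr (fun x : {ffun _ -> _} => \prod_i (two_pmf 0 (x i) * g i (x i)))); last first.
  by move=> x _; rewrite big_split.
rewrite -(bigA_distr_bigA (fun i a => two_pmf 0 a * g i a)) /=.
apply: eq_bigr => i _; rewrite big_ord_recl big_ord1 !mxE /=.
by congr (_ + _ * g i _); apply: val_inj.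
Qed.

Lemma sum_weight : \sum_x weight x = 1.
Proof.
rewrite (eq_bigr (fun x => weight x * \prod_(i < n) 1)).
  rewrite (sum_weight_prod (fun _ _ => 1)) big1 // => i _; lra.
by move=> x _; rewrite big1 ?mulr1.
Qed.

Lemma cross_prob_ge0 E : 0 <= cross_prob E.
Proof. by apply: sumr_ge0 => x _; rewrite mulr_ge0 ?weight_ge0. Qed.

Lemma cross_prob0 : cross_prob set0 = 1.
Proof.
rewrite -sum_weight; apply: eq_bigr => x _.
rewrite (_ : bichromatic x set0) ?mulr1 //.
by apply/forall_inP => e; rewrite inE.
Qed.

Lemma sum_weight_small A :
  \sum_x weight x * [forall i in A, x i == ord0]%:R = q ^+ #|A|.
Proof.
pose g i (a : 'I_2) : R := if (i \in A) && (a != ord0) then 0 else 1.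
transitivity (\sum_x weight x * \prod_i g i (x i)).
  apply: eq_bigr => x _; congr (_ * _); rewrite /g; case: (boolP [forall _ in _, _]) => [/forall_inP h|/forall_inPn].
    by rewrite big1 // => i _; case: ifP => // /andP[/h ->].
  by case=> i iA xi; rewrite (bigD1 i) //= iA xi mul0r.
rewrite sum_weight_prod /g /= (eq_bigr (fun i => if i \in A then q else 1)); last first.
  by move=> i _; case: (i \in A) => /=; ring.
by rewrite -big_mkcond /= prodr_const.
Qed.

(** Union bound: a bichromatic labelling makes some [a]-subset of [A] entirely rare. There are at
    most [2 ^ #|A|] such subsets, and each is rare with probability [q ^+ a]. *)
Lemma cross_prob_le_small E A a :
  (forall x, bichromatic x E -> (a <= #|[set v in A | x v == ord0]|)%N) ->
  cross_prob E <= 2 ^+ #|A| * q ^+ a.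
Proof.
move=> h.
have -> : 2 ^+ #|A| * q ^+ a = \sum_(B in powerset A) q ^+ a.
  by rewrite sumr_const card_powerset -[RHS]mulr_natl natrX.
apply: (@le_trans _ _ (\sum_(B in powerset A | #|B| == a) q ^+ a)); last first.
  by rewrite big_mkcondr /=; apply: ler_sum => B _; case: ifP => _ //; rewrite exprn_ge0 // ltW.
rewrite (eq_bigr (fun B : {set 'I_n} => \sum_x weight x * [forall i in B, x i == ord0]%:R)); last first.
  by move=> B /andP[_ /eqP <-]; rewrite sum_weight_small.
rewrite exchange_big /=; apply: ler_sum => x _; rewrite -mulr_sumr.
apply: ler_wpM2l; first exact: weight_ge0.
have [px|_] := boolP (bichromatic x E); last by apply: sumr_ge0.
have /card_geqP[s [us ss sA]] := h x px.
have ca : #|[set v in s]| = a by rewrite cardsE -ss; apply/card_uniqP.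
rewrite (bigD1 [set v in s]) /=; last first.
  rewrite ca eqxx andbT powersetE; apply/subsetP => v; rewrite inE => /sA.
  by rewrite inE => /andP[].
rewrite (_ : [forall i in _, _]); first by rewrite lerDl sumr_ge0.
by apply/forall_inP => v; rewrite inE => /sA; rewrite inE => /andP[].
Qed.

Lemma bichromatic_setU x E F : bichromatic x (E :|: F) = bichromatic x E && bichromatic x F.
Proof.
apply/forall_inP/andP => [h|[/forall_inP hE /forall_inP hF] e].
  by split; apply/forall_inP => e he; apply: h; rewrite inE he ?orbT.
by rewrite inE => /orP[/hE|/hF].
Qed.

Lemma eq_bichromatic x y E : (forall e i, e \in E -> i \in e -> x i = y i) ->
  bichromatic x E = bichromatic y E.
Proof.
move=> h; apply: eq_forallb_in => e eE.
apply: eq_existsb_in => i ie; apply: eq_existsb_in => j je.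
by rewrite !(h e).
Qed.

(* Exchanging the labels outside [A] of two independent samples is a measure-preserving involution. *)
Lemma cross_prob_indep A E F :
  (forall e, e \in E -> e \subset A) -> (forall e, e \in F -> [disjoint e & A]) ->
  cross_prob (E :|: F) = cross_prob E * cross_prob F.
Proof.
move=> hE hF.
pose mix (x y : {ffun 'I_n -> 'I_2}) : {ffun 'I_n -> 'I_2} := [ffun i => if i \in A then x i else y i].
pose sw (u : {ffun 'I_n -> 'I_2} * {ffun 'I_n -> 'I_2}) := (mix u.1 u.2, mix u.2 u.1).
have swK : involutive sw.
  by move=> [x y]; rewrite /sw /mix /=; congr (_, _); apply/ffunP => i; rewrite !ffunE; case: (i \in A).
rewrite /cross_prob mulr_suml.
rewrite [RHS](eq_bigr (fun x => \sum_y weight x * (bichromatic x E)%:R * (weight y * (bichromatic y F)%:R))); last first.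
  by move=> x _; rewrite mulr_sumr.
rewrite pair_big /= (reindex_inj (inv_inj swK)) /=.
transitivity (\sum_u weight u.1 * (bichromatic u.1 (E :|: F))%:R * weight u.2).
  rewrite -(pair_big xpredT xpredT (fun x y => weight x * (bichromatic x (E :|: F))%:R * weight y)) /=.
  by apply: eq_bigr => x _; rewrite -mulr_sumr sum_weight mulr1.
apply: eq_bigr => -[x y] _ /=.
have -> : bichromatic (mix x y) E = bichromatic x E.
  apply: eq_bichromatic => e i eE ie; rewrite ffunE (subsetP (hE _ eE)) //.
have -> : bichromatic (mix y x) F = bichromatic x F.
  by apply: eq_bichromatic => e i eF ie; rewrite ffunE (disjointFr (hF _ eF)).
have -> : weight (mix x y) * (bichromatic x E)%:R * (weight (mix y x) * (bichromatic x F)%:R)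
  = (weight (mix x y) * weight (mix y x)) * ((bichromatic x E)%:R * (bichromatic x F)%:R) by ring.
have -> : weight (mix x y) * weight (mix y x) = weight x * weight y.
  rewrite /weight -!big_split /=; apply: eq_bigr => i _; rewrite !ffunE.
  by case: ifP => // _; rewrite mulrC.
by rewrite bichromatic_setU; do 2 case: bichromatic => /=; ring.
Qed.

Lemma bichromatic_pair x (i j : 'I_n) :
  [exists k in [set i; j], [exists l in [set i; j], x k != x l]] = (x i != x j).
Proof.
apply/exists_inP/idP => [[k kij /exists_inP[l lij]]|xij]; last first.
  by exists i; rewrite ?set21 //; apply/exists_inP; exists j; rewrite ?set22.
by move: kij lij; rewrite !inE => /orP[]/eqP-> /orP[]/eqP->; rewrite ?eqxx // eq_sym.
Qed.

(** It suffices that the centre is rare and no vertex of [L] is; the left-hand side is the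
    probability of that event, written below as a product of vertex indicators [g]. *)
Lemma cross_prob_star_ge (c : 'I_n) (L : {set 'I_n}) E : c \notin L ->
  (forall e, e \in E -> exists2 l, l \in L & e = [set c; l]) ->
  q * (1 - q) ^+ #|L| <= cross_prob E.
Proof.
move=> cL hE.
pose g i (a : 'I_2) : R :=
  if i == c then (a == ord0)%:R else if i \in L then (a != ord0)%:R else 1.
have -> : q * (1 - q) ^+ #|L| = \sum_x weight x * \prod_i g i (x i).
  rewrite sum_weight_prod /g (bigD1 c) //= eqxx mulr1 mulr0 addr0; congr (_ * _).
  rewrite -prodr_const big_mkcond [RHS]big_mkcond /=; apply: eq_bigr => i _.
  have [->|ic] := eqVneq i c; first by rewrite (negPf cL).
  by case: (i \in L) => /=; ring.
rewrite /g; apply: ler_sum => x _; apply: ler_wpM2l; first exact: weight_ge0.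
have [_|/forall_inPn[e eE]] := boolP (bichromatic x E).
  by apply: prodr_ile1 => i; case: ifP => _; [|case: ifP => _]; rewrite ?ler01 ?lexx //; case: (x i == ord0); rewrite ?ler01 ?lexx.
case/hE: eE => l lL ->; rewrite bichromatic_pair negbK => /eqP xcl.
rewrite (bigD1 c) // (bigD1 l) /=; last by apply: contraNneq cL => <-.
rewrite eqxx (_ : (l == c) = false) ?lL ?xcl; last by apply: contraNF cL => /eqP <-.
by case: (x l == _); rewrite ?mul0r ?mulr0 ?mul1r ?mul0r.
Qed.

Variable delta : R.

(** Given the labels the edges are independent: a bichromatic edge has mean sign [delta], a
    monochromatic one has mean sign 0 and kills the whole product. *)
Lemma expectation_sbm_chi E : edge_sets E ->
  expectation (@sbm_pmf R n 2 two_pmf (cross_mx delta)) (chi R E) = delta ^+ #|E| * cross_prob E.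
Proof.
move=> hE; rewrite /expectation.
under eq_bigr do rewrite mulr_suml.
rewrite exchange_big mulr_sumr; apply: eq_bigr => x _.
rewrite /= mulrCA.
under eq_bigr do rewrite -mulrA.
rewrite -mulr_sumr; congr (_ * _).
pose bi (e : {set 'I_n}) := [exists k in e, [exists l in e, x k != x l]].
rewrite -[LHS]/(expectation _ _) (@expectation_chi _ _ _ (fun e =>
   if bi e then (1 + delta) / 2 else 1 / 2)) //; last first.
  move=> i j _; rewrite /bi bichromatic_pair mxE.
  by case: (x i == x j) => //=; rewrite addr0.
have [/forall_inP px|/forall_inPn[e eE be]] := boolP (bichromatic x E).
  rewrite mulr1 -prodr_const; apply: eq_bigr => e /px; rewrite /bi => ->.
  by field.
by rewrite (bigD1 e) //= /bi (negPf be) (_ : 2 * (1 / 2) - 1 = 0) ?mul0r ?mulr0 //; field.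
Qed.

End Labels.

Lemma expectation_half_chi (R : realType) n (E : {set {set 'I_n}}) : edge_sets E ->
  expectation (@er_half_pmf R n) (chi R E) = (E == set0)%:R.
Proof.
move=> hE; rewrite (@expectation_chi _ _ _ (fun=> 1 / 2)) //.
have [->|[e eE]] := set_0Vmem E; first by rewrite big_set0 eqxx.
rewrite (bigD1 e) //= (_ : 2 * (1 / 2) - 1 = 0) ?mul0r; last by field.
by case: eqP eE => // ->; rewrite inE.
Qed.

(** * Connected graphs and their copies *)

Local Close Scope ring_scope.

Section Graphs.
Variables (V : finType) (H : sgraph V).

Lemma card_edge e : e \in edges H -> #|e| = 2.
Proof. by case: H => E /= /forall_inP h /h /eqP. Qed.

Lemma adj_sym : symmetric (adj H).
Proof. by move=> x y; rewrite /adj /= setUC. Qed.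

Lemma adj_irrefl x : adj H x x = false.
Proof. by apply/negP => /card_edge; rewrite setUid cards1. Qed.

Lemma edge_adj e : e \in edges H -> exists x y, e = [set x; y] /\ adj H x y.
Proof.
move=> he; have /eqP/cards2P[x [y [xy exy]]] := card_edge he.
by exists x, y; split; rewrite // /adj /= -exy.
Qed.

Hypothesis connH : connected_graph H.

(** Otherwise [A] is closed under adjacency, and connectedness puts [y] in [A]. *)
Lemma leaving_edge (A : {set V}) x y : x \in A -> y \notin A ->
  exists u v, [/\ u \in A, v \notin A & adj H u v].
Proof.
move=> xA yA.
have [/existsP[u /existsP[v /and3P[]]]|noedge] :=
  boolP [exists u, [exists v, [&& u \in A, v \notin A & adj H u v]]]; first by exists u, v.
suff clA : fingraph.closed (adj H) (mem A).
  by have := closed_connect clA (connH.2 x y); rewrite /= xA (negPf yA).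
apply: (intro_closed (sym_connect_sym adj_sym)) => u v uv uA.
  apply: contraNT noedge => vA; apply/existsP; exists u; apply/existsP; exists v.
  by rewrite uA vA.
Qed.

(** A vertex set is grown from one root along leaving edges. Each step adds one vertex and at least
    one spanned edge, so [k.+1] vertices span at least [k] edges. *)
Lemma connected_card_le : #|V| <= #|edges H|.+1.
Proof.
have [/card_gt0P[r _] _] := connH.
suff grow k : k < #|V| ->
    exists A : {set V}, #|A| = k.+1 /\ k <= #|[set e in edges H | e \subset A]|.
  have [|A [cA]] := grow #|V|.-1; first by rewrite prednK //; apply/card_gt0P; exists r.
  have : #|[set e in edges H | e \subset A]| <= #|edges H|.
    by apply/subset_leq_card/subsetP => e; rewrite inE => /andP[].
  lia.
elim: k => [|k IHk] kV; first by exists [set r]; rewrite cards1.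
have [|A [cA kA]] := IHk; first exact: ltnW.
have [y yA] : exists y, y \notin A; last first.
  have /card_gt0P[x xA] : 0 < #|A| by rewrite cA.
  have [u [v [uA vA uv]]] := leaving_edge xA yA.
  exists (v |: A); split; first by rewrite cardsU1 vA cA.
  apply: (@leq_trans #|[set u; v] |: [set e in edges H | e \subset A]|).
    rewrite cardsU1 inE negb_and (_ : [set u; v] \subset A = false) ?orbT //.
    by apply: contraNF vA => /subsetP; apply; rewrite set22.
  apply/subset_leq_card/subsetP => e; rewrite !inE => /orP[/eqP ->|/andP[-> eA]].
    rewrite [_ \in _]uv /=; apply/subsetP => z; rewrite !inE => /orP[]/eqP->.
      by rewrite uA orbT.
    by rewrite eqxx.
  by rewrite (subset_trans eA) // subsetUr.
by apply/existsP; rewrite -negb_forall; apply: contraL kV => /forallP hA;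
   rewrite -leqNgt -cA; apply/subset_leq_card/subsetP.
Qed.

Lemma connected_covered v : 0 < #|edges H| -> exists2 e, e \in edges H & v \in e.
Proof.
case/card_gt0P => e /edge_adj[x [y [_ xy]]].
have [z zv] : exists z, z \notin [set v].
  have [<-|xv] := eqVneq x v; last by exists x; rewrite inE.
  by exists y; rewrite inE; apply: contraTneq xy => ->; rewrite adj_irrefl.
have [u [w [uv _ uw]]] := leaving_edge (set11 v) zv.
by exists [set u; w] => //; move: uv; rewrite inE => /eqP ->; rewrite set21.
Qed.

Lemma adj_star D (x y : 'I_D.+1) : adj (star D) x y = (x == ord0) (+) (y == ord0).
Proof.
apply/imsetP/idP => [[i _ exy]|].
  have : ord0 \in [set x; y] by rewrite exy set21.
  have : lift ord0 i \in [set x; y] by rewrite exy set22.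
  by rewrite !inE => /orP[]/eqP <- /orP[]/eqP //= e; rewrite -?e ?eqxx.
have [->|x0] := eqVneq x ord0; have [->|y0] := eqVneq y ord0 => //= _;
  [rewrite eq_sym in y0|rewrite eq_sym in x0].
  by have [i -> _] := unlift_some y0; exists i.
by have [i -> _] := unlift_some x0; exists i => //; rewrite setUC.
Qed.

(** Every vertex other than [c] lies on some edge, and that edge also contains [c]. Hence adjacency
    means that exactly one endpoint is [c], and counting edges gives [D.+1] vertices. *)
Lemma connected_common_vertex_star D c : #|edges H| = D -> 0 < D ->
  (forall e, e \in edges H -> c \in e) -> graph_iso H (star D).
Proof.
move=> eD D0 hc.
have adjE x y : adj H x y = (x == c) (+) (y == c).
  have adjc z : z != c -> adj H c z.
    move=> zc; have [|e eH ze] := @connected_covered z; first by rewrite eD.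
    have ce := hc e eH; rewrite /adj /= (_ : [set c; z] = e) //.
    apply/eqP; rewrite eqEcard (card_edge eH) cards2 eq_sym zc andbT.
    by apply/subsetP => u; rewrite !inE => /orP[]/eqP->.
  have [->|xc] := eqVneq x c; have [->|yc] := eqVneq y c => /=.
  - exact: adj_irrefl.
  - exact: adjc.
  - by rewrite adj_sym adjc.
  - apply/negP => /hc; rewrite !inE => /orP[]/eqP ec; first by rewrite ec eqxx in xc.
    by rewrite ec eqxx in yc.
have cardV : #|V| = D.+1.
  have -> : #|V| = #|[set~ c]|.+1 by rewrite cardsC1 prednK //; apply/card_gt0P; exists c.
  congr _.+1; rewrite -eD.
  have -> : edges H = [set [set c; z] | z in [set~ c]].
    apply/setP => e; apply/idP/imsetP => [eH|[z]]; last first.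
      by rewrite !inE => zc ->; have := adjE c z; rewrite eqxx (negPf zc).
    have [x [y [exy xy]]] := edge_adj eH.
    move: xy; rewrite adjE; have [xc|xc] := eqVneq x c.
      by rewrite addTb => yc; exists y; rewrite ?inE // exy xc.
    by rewrite addFb => /eqP yc; exists x; rewrite ?inE // exy yc setUC.
  rewrite card_in_imset // => x y; rewrite !inE => xc yc exy.
  have : x \in [set c; y] by rewrite -exy set22.
  by rewrite !inE (negPf xc) => /eqP.
pose f0 v : 'I_D.+1 := cast_ord cardV (enum_rank v).
have f0_inj : injective f0 by move=> u v /cast_ord_inj /enum_rank_inj.
(* An arbitrary enumeration is corrected by a transposition so that [c] goes to the centre
   [ord0]. *)
pose f v := tperm ord0 (f0 c) (f0 v).
have f_inj : injective f by move=> u v /perm_inj /f0_inj.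
have fc : f c = ord0 by rewrite /f tpermR.
exists f; first by apply: inj_card_bij => //; rewrite card_ord cardV.
by move=> x y; rewrite adj_star adjE -fc !(inj_eq f_inj).
Qed.

End Graphs.

(** * Copies of a graph inside the complete graph, and their number *)

Section Copies.
Variables (V : finType) (H : sgraph V) (n : nat).

Definition is_copy (S : {set 'I_n} * {set {set 'I_n}}) : bool :=
  is_subgraph S && subgraph_iso H S.

Definition embed (f : V -> 'I_n) : {set 'I_n} * {set {set 'I_n}} :=
  (f @: [set: V], [set f @: e | e : {set V} in edges H]).

Lemma copyP (S : {set 'I_n} * {set {set 'I_n}}) :
  reflect (exists2 f : {ffun V -> 'I_n}, injective f & S = embed f) (is_copy S).
Proof.
apply: (iffP andP) => [[/forall_inP subS /existsP[f /and3P[/injectiveP finj /eqP S1 /forallP S2]]]|].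
  have {}S2 x y : ([set f x; f y] \in S.2) = adj H x y.
    by have /forallP/(_ y)/eqP := S2 x.
  exists f => //; rewrite /embed S1; case: S subS S1 S2 => S1 S2 /= subS hS1 hS2; congr (_, _).
  apply/setP => e; apply/idP/imsetP => [eS|[d dH ->]].
    have /andP[/subsetP eS1 /cards2P[a [b [_ eab]]]] := subS e eS.
    have /imsetP[x _ ax] : a \in f @: [set: V] by rewrite hS1 eS1 // eab set21.
    have /imsetP[y _ bx] : b \in f @: [set: V] by rewrite hS1 eS1 // eab set22.
    exists [set x; y]; last by rewrite eab imsetU !imset_set1 ax bx.
    by rewrite -[_ \in _]/(adj H x y) -hS2 -ax -bx -eab.
  have [x [y [-> xy]]] := edge_adj dH.
  by rewrite imsetU !imset_set1 hS2.
case=> f finj ->; split.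
  apply/forall_inP => _ /imsetP[e eH ->] /=; rewrite imsetS ?subsetT //=.
  by rewrite card_imset // (card_edge eH).
apply/existsP; exists f; apply/and3P; split => //=; first exact/injectiveP.
apply/forallP => x; apply/forallP => y; apply/eqP; apply/imsetP/idP => [[e eH]|xy].
  have <- : f @: [set x; y] = [set f x; f y] by rewrite imsetU !imset_set1.
  by move=> exy; rewrite /adj /= (imset_inj finj exy).
by exists [set x; y] => //; rewrite imsetU !imset_set1.
Qed.

Section OneCopy.
Variables (S : {set 'I_n} * {set {set 'I_n}}) (copS : is_copy S).

Lemma card_copy_vertices : #|S.1| = #|V|.
Proof. by have /copyP[f finj ->] := copS; rewrite card_imset // cardsT. Qed.

Lemma card_copy_edges : #|S.2| = #|edges H|.
Proof. by have /copyP[f finj ->] := copS; rewrite card_imset //; apply: imset_inj. Qed.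

Lemma edge_sets_copy : edge_sets S.2.
Proof.
have /andP[/forall_inP subS _] := copS.
by apply/forall_inP => e /subS /andP[].
Qed.

Lemma copy_edge_sub e : e \in S.2 -> e \subset S.1.
Proof. by have /andP[/forall_inP subS _] := copS => /subS /andP[]. Qed.

End OneCopy.

(** Each copy is the image of at least one injection, so passing to injections can only
    overcount. *)
Lemma sum_copies_le (F : {set 'I_n} * {set {set 'I_n}} -> nat) :
  \sum_(S | is_copy S) F S <= \sum_(f : {ffun V -> 'I_n} | injectiveb f) F (embed f).
Proof.
rewrite (partition_big (fun f : {ffun V -> 'I_n} => embed f) is_copy) /=; last first.
  by move=> f /injectiveP finj; apply/copyP; exists f.
apply: leq_sum => S /copyP[f finj ->].
rewrite (bigD1 f) /=; first exact: leq_addr.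
by rewrite eqxx andbT; apply/injectiveP.
Qed.

Lemma card_copies_le : #|is_copy| <= n ^ #|V|.
Proof.
rewrite -sum1_card (leq_trans (sum_copies_le (fun=> 1))) //.
by rewrite sum1_card (leq_trans (max_card _)) // card_ffun card_ord.
Qed.

(** The injections are grouped by their image copy. Those giving [S] take values in [S.1], which has
    [#|V|] elements, so there are at most [#|V| ^ #|V|] of them. *)
Lemma card_copies_ge : n ^_ #|V| <= #|is_copy| * #|V| ^ #|V|.
Proof.
have := card_inj_ffuns V 'I_n; rewrite card_ord => <-.
rewrite -sum1dep_card (partition_big (fun f : {ffun V -> 'I_n} => embed f) is_copy) /=; last first.
  by move=> f /injectiveP finj; apply/copyP; exists f.
rewrite -sum_nat_const; apply: leq_sum => S copS.
rewrite sum1dep_card -{1}(card_copy_vertices copS) -card_ffun_on.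
apply/subset_leq_card/subsetP => f; rewrite inE => /andP[_ /eqP eS].
by apply/ffun_onP => v; rewrite -eS imset_f.
Qed.

(* The weight [n ^ w] of a pair sharing [w] vertices compensates the number of such pairs;
   summed over all maps it factors over the vertices of the second copy. *)
Lemma sum_copy_pairs_le :
  \sum_(S | is_copy S) \sum_(T | is_copy T) n ^ #|S.1 :&: T.1| <=
  n ^ #|V| * ((#|V|.+1 * n) ^ #|V|).
Proof.
have one S : is_copy S ->
    \sum_(T | is_copy T) n ^ #|S.1 :&: T.1| <= (#|V|.+1 * n) ^ #|V|.
  move=> copS; apply: leq_trans (sum_copies_le (fun T => n ^ #|S.1 :&: T.1|)) _.
  pose h (y : 'I_n) := if y \in S.1 then n else 1.
  apply: (@leq_trans (\sum_(g : {ffun V -> 'I_n}) \prod_v h (g v))).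
    rewrite big_mkcond /=; apply: leq_sum => g _; case: ifP => // /injectiveP ginj.
    rewrite (_ : S.1 :&: _ = g @: [set v | g v \in S.1]).
      rewrite card_imset // -prod_nat_const big_mkcond /=.
      by apply: eq_leq; apply: eq_bigr => v _; rewrite inE.
    apply/setP => y; apply/setIP/imsetP => [[yS /imsetP[v _ yv]]|[v]].
      by exists v; rewrite // inE -yv.
    by rewrite inE => vS ->; rewrite imset_f.
  rewrite -(bigA_distr_bigA (fun _ y => h y)) /= prod_nat_const.
  have [->|V0] := posnP #|V|; rewrite ?expn0 // leq_exp2r //.
  rewrite (bigID (mem S.1)) /= mulSn addnC.
  apply: leq_add.
    rewrite (eq_bigr (fun=> 1)); last by move=> y yS; rewrite /h (negPf yS).
    by rewrite sum1_card (leq_trans (max_card _)) // card_ord.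
  rewrite (eq_bigr (fun=> n)); last by move=> y yS; rewrite /h yS.
  by rewrite sum_nat_const (card_copy_vertices copS).
apply: (@leq_trans (\sum_(S | is_copy S) (#|V|.+1 * n) ^ #|V|)); first by apply: leq_sum => S; apply: one.
by rewrite sum_nat_const leq_mul2r card_copies_le orbT.
Qed.

End Copies.

Local Open Scope ring_scope.

(** * Means and variances of signed counts *)

Section Moments.
Variables (R : realType) (n : nat).
Implicit Types (mu f g : sgraph 'I_n -> R).

Lemma eq_expectation mu f g : f =1 g -> expectation mu f = expectation mu g.
Proof. by move=> fg; apply: eq_bigr => G _; rewrite fg. Qed.

Lemma expectation_sum mu (I : finType) (P : pred I) (F : I -> sgraph 'I_n -> R) :
  expectation mu (fun G => \sum_(i | P i) F i G) = \sum_(i | P i) expectation mu (F i).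
Proof. by rewrite /expectation exchange_big; apply: eq_bigr => G _; rewrite mulr_sumr. Qed.

Lemma variance_expand mu f : expectation mu (fun=> 1) = 1 ->
  variance mu f = expectation mu (fun G => f G * f G) - expectation mu f ^+ 2.
Proof.
move=> mu1; rewrite /variance; have [m mE] : {m | m = expectation mu f} by exists (expectation mu f).
rewrite -mE.
have -> : m ^+ 2 = 2 * m * expectation mu f - m ^+ 2 * expectation mu (fun=> 1).
  by rewrite mu1 -mE; ring.
rewrite /expectation !mulr_sumr -!sumrB; apply: eq_bigr => G _.
by ring.
Qed.

Variables (V : finType) (H : sgraph V).

Lemma expectation_signed_count mu :
  expectation mu (@signed_count R V H n) = \sum_(S | is_copy H S) expectation mu (chi R S.2).
Proof. by rewrite -expectation_sum. Qed.

(** The variance is the sum of the covariances of all pairs of copies, and a product of two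
    characters is again a character. The hypothesis is total mass one, stated through the empty
    character. *)
Lemma variance_signed_count mu : expectation mu (chi R set0) = 1 ->
  variance mu (@signed_count R V H n) =
  \sum_(S | is_copy H S) \sum_(T | is_copy H T)
    (expectation mu (chi R (symdiff S.2 T.2)) -
     expectation mu (chi R S.2) * expectation mu (chi R T.2)).
Proof.
move=> mu1; rewrite variance_expand; last first.
  by rewrite -[RHS]mu1; apply: eq_expectation => G; rewrite /chi big_set0.
under [RHS]eq_bigr do rewrite sumrB -mulr_sumr.
rewrite sumrB -mulr_suml -expectation_signed_count -expr2; congr (_ - _).
under [RHS]eq_bigr do rewrite -expectation_sum.
rewrite -expectation_sum; apply: eq_expectation => G.
rewrite /signed_count mulr_suml; apply: eq_bigr => S _.
by rewrite mulr_sumr; apply: eq_bigr => T _; rewrite chiM.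
Qed.

Hypothesis edgeH : (0 < #|edges H|)%N.

Lemma copy_edges_neq0 (S : {set 'I_n} * {set {set 'I_n}}) : is_copy H S -> S.2 != set0.
Proof. by move=> copS; rewrite -card_gt0 (card_copy_edges copS). Qed.

Lemma expectation_half_signed_count :
  expectation (@er_half_pmf R n) (@signed_count R V H n) = 0.
Proof.
rewrite expectation_signed_count big1 // => S copS.
by rewrite (expectation_half_chi _ (edge_sets_copy copS)) (negPf (copy_edges_neq0 copS)).
Qed.

(** Nonempty characters have mean 0 under the unbiased law, and a symmetric difference is empty only
    for equal edge sets: the characters are orthonormal. *)
Lemma variance_half_signed_count :
  variance (@er_half_pmf R n) (@signed_count R V H n) =
  \sum_(S | is_copy (n := n) H S) \sum_(T | is_copy (n := n) H T) (S.2 == T.2)%:R.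
Proof.
have e0 : @edge_sets n set0 by apply/forall_inP => e; rewrite inE.
rewrite variance_signed_count ?(expectation_half_chi _ e0) ?eqxx //.
apply: eq_bigr => S copS; apply: eq_bigr => T copT.
have eS := edge_sets_copy copS; have eT := edge_sets_copy copT.
rewrite (expectation_half_chi _ (edge_sets_symdiff eS eT)) (expectation_half_chi _ eS).
by rewrite symdiff_eq0 (negPf (copy_edges_neq0 copS)) mul0r subr0.
Qed.

Lemma variance_half_ge : #|is_copy (n := n) H|%:R <= variance (@er_half_pmf R n) (@signed_count R V H n).
Proof.
rewrite variance_half_signed_count -sumr_const; apply: ler_sum => S copS.
by rewrite (bigD1 S) //= eqxx lerDl sumr_ge0.
Qed.

End Moments.

(** * The two-community model at a fixed number of vertices *)

Section TwoBlocks.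
Variables (R : realType) (q delta : R) (n : nat).
Hypotheses (q_gt0 : 0 < q) (q_lt1 : q < 1) (delta_gt0 : 0 < delta).

Let P := @sbm_pmf R n 2 (two_pmf q) (cross_mx delta).
Let phi (E : {set {set 'I_n}}) := delta ^+ #|E| * cross_prob q E.

Let phi_ge0 E : 0 <= phi E.
Proof. by rewrite mulr_ge0 ?exprn_ge0 ?cross_prob_ge0 // ltW. Qed.

Let expectation_P E : edge_sets E -> expectation P (chi R E) = phi E.
Proof. exact: expectation_sbm_chi. Qed.

Lemma bichromatic_small_vertex (E : {set {set 'I_n}})
    (A : {set 'I_n}) (x : {ffun 'I_n -> 'I_2}) :
  edge_sets E -> E != set0 -> (forall e, e \in E -> e \subset A) -> bichromatic x E ->
  (0 < #|[set v in A | x v == ord0]|)%N.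
Proof.
move=> /forall_inP E2 /set0Pn[e eE] EA /forall_inP px.
have /cards2P[u [v [_ euv]]] := E2 e eE.
have := px e eE; rewrite euv bichromatic_pair ord2_neq.
have /subsetP eA := EA e eE.
have [xu _|_] := boolP (x u == ord0).
  by apply/card_gt0P; exists u; rewrite inE xu eA // euv set21.
by rewrite addFb => xv; apply/card_gt0P; exists v; rewrite inE eA // euv set22.
Qed.

Section Pattern.
Variables (V : finType) (H : sgraph V).
Hypothesis edgeH : (0 < #|edges H|)%N.

(** The unbiased mean vanishes and every [phi] is nonnegative, so no cancellation occurs and the
    absolute value disappears. *)
Lemma sc_gap_sbm : `| expectation P (@signed_count R V H n)
     - expectation (@er_half_pmf R n) (@signed_count R V H n) | = \sum_(S | is_copy H S) phi S.2.
Proof.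
rewrite expectation_half_signed_count // subr0 expectation_signed_count.
rewrite (eq_bigr (fun S : {set 'I_n} * {set {set 'I_n}} => phi S.2)).
  by rewrite ger0_norm // sumr_ge0.
by move=> S /edge_sets_copy /expectation_P.
Qed.

(** Every edge has a rare endpoint. If there were only one rare vertex, all edges would pass through
    it, and [H] would be a star. *)
Lemma small_vertices_copy (S : {set 'I_n} * {set {set 'I_n}}) (x : {ffun 'I_n -> 'I_2}) :
  connected_graph H -> ~ graph_iso H (star #|edges H|) -> is_copy H S -> bichromatic x S.2 ->
  (1 < #|[set v in S.1 | x v == ord0]|)%N.
Proof.
move=> connH nstar /copyP[f finj ->] /forall_inP px.
rewrite ltnNge; apply/negP => small; apply: nstar.
have small_edge e : e \in edges H -> exists2 v, v \in e & x (f v) == ord0.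
  move=> eH; have [u [v [euv uv]]] := edge_adj eH.
  have := px (f @: e) (imset_f _ eH).
  rewrite euv imsetU !imset_set1 bichromatic_pair ord2_neq.
  have [xu _|_] := boolP (x (f u) == ord0); first by exists u; rewrite ?set21.
  by rewrite addFb => xv; exists v; rewrite ?set22.
have [e0 e0H] : exists e, e \in edges H by apply/card_gt0P.
have [c _ xc] := small_edge _ e0H.
apply: (@connected_common_vertex_star _ _ connH _ c) => // e /small_edge[v ve xv].
rewrite (_ : c = v) //; apply: finj; apply: (card_le1_eqP small).
  by rewrite inE imset_f.
by rewrite inE imset_f.
Qed.

(** With fewer than [D] edges [H] may still be a smaller star, so only one rare vertex is
    guaranteed; with exactly [D] edges stars are excluded and there are two. *)
Lemma cross_prob_copy_le (S : {set 'I_n} * {set {set 'I_n}}) D :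
  connected_graph H -> (#|edges H| <= D)%N -> ~ graph_iso H (star D) -> is_copy H S ->
  cross_prob q S.2 <= 2 ^+ #|V| * q ^+ (if (#|edges H| < D)%N then 1 else 2).
Proof.
move=> connH eD nstar copS; rewrite -(card_copy_vertices copS).
apply: cross_prob_le_small => // x px; case: ltnP => De.
  apply: bichromatic_small_vertex px; rewrite ?(edge_sets_copy copS) ?(copy_edges_neq0 edgeH copS) //.
  exact: copy_edge_sub copS.
by apply: small_vertices_copy px; rewrite // (_ : #|edges H| = D) //; apply/eqP; rewrite eqn_leq eD.
Qed.

(** Each of the [N] copies contributes at most [B]. In the squared gap, one factor [N] is at most
    [n ^ #|V|] and the other is at most the unbiased variance. *)
Lemma sc_gap_le D : connected_graph H -> (#|edges H| <= D)%N -> ~ graph_iso H (star D) ->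
  (\sum_(S : {set 'I_n} * {set {set 'I_n}} | is_copy H S) phi S.2) ^+ 2 <=
  4 ^+ #|V| * (n%:R ^+ #|V| * delta ^+ (2 * #|edges H|)
     * q ^+ (2 * (if (#|edges H| < D)%N then 1 else 2)))
  * variance (@er_half_pmf R n) (@signed_count R V H n).
Proof.
move=> connH eD nstar; set a := if _ then _ else _.
have d0 : 0 <= delta by rewrite ltW.
have q0 : 0 <= q by rewrite ltW.
set N := #|is_copy (n := n) H|.
set B : R := delta ^+ #|edges H| * (2 ^+ #|V| * q ^+ a).
have B0 : 0 <= B by rewrite /B !mulr_ge0 // exprn_ge0.
have leNB : \sum_(S : {set 'I_n} * {set {set 'I_n}} | is_copy H S) phi S.2 <= N%:R * B.
  rewrite mulr_natl -sumr_const; apply: ler_sum => S copS.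
  rewrite /phi (card_copy_edges copS) /B ler_wpM2l ?exprn_ge0 //.
  exact: cross_prob_copy_le.
have -> : 4 ^+ #|V| * (n%:R ^+ #|V| * delta ^+ (2 * #|edges H|) * q ^+ (2 * a)) =
   n%:R ^+ #|V| * B ^+ 2.
  have -> : 4 ^+ #|V| = 2 ^+ #|V| * 2 ^+ #|V| :> R by rewrite -exprMn -natrM.
  rewrite /B (mulnC 2 #|_|) (mulnC 2 a) !exprM.
  move: (n%:R ^+ _) (delta ^+ _) (q ^+ a) (2 ^+ _) => u v w z; ring.
apply: (@le_trans _ _ ((N%:R * B) ^+ 2)).
  have sum_ge0 : 0 <= \sum_(S : {set 'I_n} * {set {set 'I_n}} | is_copy H S) phi S.2.
    by apply: sumr_ge0 => S _; apply: phi_ge0.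
  have NB0 : 0 <= N%:R * B by apply: mulr_ge0.
  by rewrite ler_pXn2r // nnegrE.
apply: (@le_trans _ _ (n%:R ^+ #|V| * B ^+ 2 * N%:R)); last first.
  by rewrite ler_wpM2l ?variance_half_ge // mulr_ge0 ?exprn_ge0.
rewrite exprMn expr2 -mulrA [_ * B ^+ 2 * _]mulrC ler_wpM2l // ler_wpM2r ?exprn_ge0 //.
by rewrite -natrX ler_nat card_copies_le.
Qed.

End Pattern.

(** * Pairs of stars: covariances, variances and the mean of the star count *)

Section StarPairs.
Variable D : nat.
Hypothesis D_gt0 : (0 < D)%N.
Implicit Types S T : {set 'I_n} * {set {set 'I_n}}.

Lemma card_edges_star : #|edges (star D)| = D.
Proof.
rewrite /= /star_edges card_imset ?card_ord // => i j eij.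
have : lift ord0 i \in [set ord0; lift ord0 j] by rewrite -eij set22.
by rewrite !inE /= => /eqP /lift_inj.
Qed.

Lemma star_copyP S : is_copy (star D) S ->
  exists2 c, c \in S.1 & forall e, e \in S.2 -> exists2 l, l \in S.1 :\ c & e = [set c; l].
Proof.
case/copyP => f finj ->; exists (f ord0); first by rewrite imset_f.
move=> _ /imsetP[_ /imsetP[i _ ->] ->]; exists (f (lift ord0 i)).
  by rewrite !inE (inj_eq finj) imset_f.
by rewrite imsetU !imset_set1.
Qed.

(** A common edge contains the centre of [S], which is then a shared vertex. The common edges are
    determined by their leaves, which are shared vertices other than that centre. *)
Lemma star_common_edges S T : is_copy (star D) S -> is_copy (star D) T ->
  (0 < #|S.1 :&: T.1|)%N -> (#|S.2 :&: T.2| < #|S.1 :&: T.1|)%N.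
Proof.
move=> copS copT w0.
have [->|[e0]] := set_0Vmem (S.2 :&: T.2); first by rewrite cards0.
case/setIP => e0S e0T.
have [c cS hS] := star_copyP copS.
have cT : c \in T.1.
  have [l _ e0E] := hS _ e0S.
  by apply: (subsetP (copy_edge_sub copT e0T)); rewrite e0E set21.
rewrite (cardsD1 c (S.1 :&: T.1)) inE cS cT add1n ltnS.
apply: (@leq_trans #|[set [set c; l] | l in (S.1 :&: T.1) :\ c]|); last exact: leq_imset_card.
apply/subset_leq_card/subsetP => e /setIP[eS eT].
have [l lS eE] := hS _ eS; apply/imsetP; exists l => //.
move: lS; rewrite !inE => /andP[-> ->] /=.
by apply: (subsetP (copy_edge_sub copT eT)); rewrite eE set22.
Qed.

Lemma phi_star_pair_le S T (K : R) : is_copy (star D) S -> is_copy (star D) T ->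
  (0 < #|S.1 :&: T.1|)%N -> 1 <= n%:R * delta ^+ 2 ->
  1 <= n%:R ^+ D.+1 * K ->
  2 ^+ (2 * D.+1) * q * delta ^+ (2 * D) <= n%:R * K ->
  phi (symdiff S.2 T.2) <= n%:R ^+ #|S.1 :&: T.1| * K.
Proof.
move=> copS copT w0 nd K1 K2.
have d0 : 0 <= delta by rewrite ltW.
have q0 : 0 <= q by rewrite ltW.
have n1 : 1 <= n%:R :> R.
  by case: (n) nd => [|m]; [rewrite mul0r ler10|rewrite ler1n].
have K0 : 0 <= K.
  by rewrite -(@pmulr_rge0 _ (n%:R ^+ D.+1)) ?(le_trans ler01) // exprn_gt0 // (lt_le_trans ltr01).
have kw := star_common_edges copS copT w0.
have nle i j : (i <= j)%N -> n%:R ^+ i * K <= n%:R ^+ j * K.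
  by move=> ij; rewrite ler_wpM2r // ler_weXn2l.
have [eST|nST] := eqVneq S.2 T.2.
  (* Equal edge sets share [D] edges, hence at least [D.+1] vertices, so the first bound on [K]
     covers the value 1 of [phi]. *)
  have /eqP -> : symdiff S.2 T.2 == set0 by rewrite symdiff_eq0 eST.
  rewrite /phi cards0 cross_prob0 expr0 mulr1 (le_trans K1) // nle //.
  by move: kw; rewrite -eST setIid (card_copy_edges copS) card_edges_star.
set k := #|S.2 :&: T.2| in kw *.
have cE : (#|symdiff S.2 T.2| + 2 * k = 2 * D)%N.
  by rewrite card_symdiff (card_copy_edges copS) (card_copy_edges copT) card_edges_star mul2n addnn.
have cA : (#|S.1 :|: T.1| <= 2 * D.+1)%N.
  rewrite (leq_trans (leq_card_setU _ _)) // (card_copy_vertices copS) (card_copy_vertices copT).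
  by rewrite card_ord mul2n addnn.
have eE : edge_sets (symdiff S.2 T.2).
  by apply: edge_sets_symdiff; [exact: edge_sets_copy copS|exact: edge_sets_copy copT].
(* The symmetric difference may be disconnected, but it is nonempty, which guarantees one rare
   vertex. *)
have pE : cross_prob q (symdiff S.2 T.2) <= 2 ^+ (2 * D.+1) * q.
  apply: (@le_trans _ _ (2 ^+ #|S.1 :|: T.1| * q ^+ 1)).
    apply: cross_prob_le_small => // x; apply: bichromatic_small_vertex; rewrite ?symdiff_eq0 //.
    move=> e; rewrite !inE => /orP[]/andP[_].
      by move/(copy_edge_sub copS)/subset_trans; apply; rewrite subsetUl.
    by move/(copy_edge_sub copT)/subset_trans; apply; rewrite subsetUr.
  by rewrite expr1 ler_wpM2r // ler_weXn2l // ler1n.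
(* Each shared edge removes two factors [delta] from the product; this costs at most a factor [n],
   as [n * delta ^ 2] is at least 1. *)
have dE : delta ^+ #|symdiff S.2 T.2| <= delta ^+ (2 * D) * n%:R ^+ k.
  rewrite -cE exprD -mulrA ler_peMr ?exprn_ge0 // exprM -exprMn mulrC.
  by rewrite exprn_ege1 // mulrC.
(* Sharing [k] edges means sharing at least [k.+1] vertices; the spare factor [n] is the one in the
   second bound on [K]. *)
apply: le_trans (nle _ _ kw); rewrite exprS.
apply: (@le_trans _ _ (delta ^+ (2 * D) * n%:R ^+ k * (2 ^+ (2 * D.+1) * q))).
  by apply: ler_pM => //; rewrite ?exprn_ge0 // cross_prob_ge0.
rewrite [X in X <= _](_ : _ = n%:R ^+ k * (2 ^+ (2 * D.+1) * q * delta ^+ (2 * D))); last first.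
  by move: (2 ^+ _) (delta ^+ _) (n%:R ^+ _) => x y z; ring.
by rewrite [n%:R * _]mulrC -[X in _ <= X]mulrA ler_wpM2l ?exprn_ge0.
Qed.

(** Stars without common vertices depend on disjoint sets of labels, so their covariance is zero. *)
Lemma phi_star_indep S T : is_copy (star D) S -> is_copy (star D) T ->
  #|S.1 :&: T.1| = 0%N -> phi (symdiff S.2 T.2) = phi S.2 * phi T.2.
Proof.
move=> copS copT /cards0_eq ST0.
have dis e : e \in T.2 -> [disjoint e & S.1].
  move=> eT; rewrite disjoint_sym; apply: disjointWr (copy_edge_sub copT eT) _.
  by rewrite -setI_eq0 ST0.
have ST2 : S.2 :&: T.2 = set0.
  apply/setP => e; rewrite !inE; apply/negP => /andP[eS eT].
  have := dis e eT; rewrite disjoint_sym => /disjoint_setI0.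
  move/setIidPr: (copy_edge_sub copS eS) => -> e0.
  by have /forall_inP/(_ e eS) := edge_sets_copy copS; rewrite e0 cards0.
have cD := card_symdiff S.2 T.2; rewrite ST2 cards0 muln0 addn0 in cD.
rewrite /phi cD (_ : symdiff S.2 T.2 = S.2 :|: T.2); last first.
  apply/setP => e; rewrite in_symdiff; have := in_set0 e; rewrite -ST2 !inE.
  by case: (e \in S.2); case: (e \in T.2).
rewrite (@cross_prob_indep _ _ n S.1) //; last exact: copy_edge_sub copS.
by rewrite exprD mulrACA.
Qed.

Variable K : R.
Hypotheses (n_delta : 1 <= n%:R * delta ^+ 2) (K1 : 1 <= n%:R ^+ D.+1 * K)
  (K2 : 2 ^+ (2 * D.+1) * q * delta ^+ (2 * D) <= n%:R * K).

Let K_ge0 : 0 <= K.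
Proof.
rewrite -(@pmulr_rge0 _ (n%:R ^+ D.+1)) ?(le_trans ler01) // exprn_gt0 // lt0r ler0n andbT.
by apply: contraTneq n_delta => ->; rewrite mul0r ler10.
Qed.

Let pair_bound : \sum_(S | is_copy (n := n) (star D) S) \sum_(T | is_copy (n := n) (star D) T)
    n%:R ^+ #|S.1 :&: T.1| * K <= n%:R ^+ D.+1 * (D.+2%:R * n%:R) ^+ D.+1 * K.
Proof.
under eq_bigr do rewrite -mulr_suml.
rewrite -mulr_suml ler_wpM2r //.
have := sum_copy_pairs_le (star D) n; rewrite card_ord -(ler_nat R) natrM !natrX natrM.
apply: le_trans; rewrite natr_sum ler_sum // => S _.
by rewrite natr_sum ler_sum // => T _; rewrite natrX.
Qed.

Lemma variance_sbm_star_le :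
  variance P (@signed_count R _ (star D) n) <= n%:R ^+ D.+1 * (D.+2%:R * n%:R) ^+ D.+1 * K.
Proof.
apply: le_trans pair_bound.
have e0 : @edge_sets n set0 by apply/forall_inP => e; rewrite inE.
rewrite variance_signed_count; last first.
  by rewrite expectation_P // /phi cards0 cross_prob0 expr0 mulr1.
apply: ler_sum => S copS; apply: ler_sum => T copT.
have eS := edge_sets_copy copS; have eT := edge_sets_copy copT.
rewrite !expectation_P ?edge_sets_symdiff //.
have [w0|w0] := posnP #|S.1 :&: T.1|.
  by rewrite phi_star_indep // subrr w0 expr0 mul1r.
apply: le_trans (phi_star_pair_le copS copT w0 n_delta K1 K2).
by rewrite gerBl mulr_ge0.
Qed.

(** Only pairs with equal edge sets count here. Each contributes 1, which is [phi] of the empty set,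
    so the pair bound for the block model applies again. *)
Lemma variance_half_star_le :
  variance (@er_half_pmf R n) (@signed_count R _ (star D) n) <=
  n%:R ^+ D.+1 * (D.+2%:R * n%:R) ^+ D.+1 * K.
Proof.
apply: le_trans pair_bound.
rewrite variance_half_signed_count ?card_edges_star //.
apply: ler_sum => S copS; apply: ler_sum => T copT.
have n0 : 0 <= n%:R ^+ #|S.1 :&: T.1| * K by rewrite mulr_ge0 ?exprn_ge0.
have [eST|//] := eqVneq S.2 T.2.
have w0 : (0 < #|S.1 :&: T.1|)%N.
  have /set0Pn[e eS] : S.2 != set0 by apply: copy_edges_neq0 copS; rewrite card_edges_star.
  have eT : e \in T.2 by rewrite -eST.
  rewrite (@leq_trans #|e|) //; last first.
    by apply: subset_leq_card; rewrite subsetI (copy_edge_sub copS) ?(copy_edge_sub copT).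
  by have /forall_inP/(_ e eS)/eqP -> := edge_sets_copy copS.
apply: le_trans (phi_star_pair_le copS copT w0 n_delta K1 K2).
have /eqP -> : symdiff S.2 T.2 == set0 by rewrite symdiff_eq0 eST.
by rewrite /phi cards0 cross_prob0 expr0 mulr1.
Qed.

Lemma sc_gap_star_ge :
  #|is_copy (n := n) (star D)|%:R * (q * (1 - q) ^+ D * delta ^+ D) <=
  \sum_(S : {set 'I_n} * {set {set 'I_n}} | is_copy (star D) S) phi S.2.
Proof.
rewrite mulr_natl -sumr_const; apply: ler_sum => S copS.
rewrite /phi (card_copy_edges copS) card_edges_star mulrC ler_wpM2l //; first by rewrite exprn_ge0 ?ltW.
have [c cS hS] := star_copyP copS.
have cL : #|S.1 :\ c| = D.
  by have := cardsD1 c S.1; rewrite cS (card_copy_vertices copS) card_ord => -[].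
by rewrite -{1}cL; apply: (cross_prob_star_ge q_gt0 q_lt1 _ hS); rewrite setD11.
Qed.

End StarPairs.
End TwoBlocks.

(** * Choice of the parameters *)

Section Asymptotics.
Variables (R : realType) (D : nat).
Hypothesis hD : (3 <= D)%N.

(** This is 1/t for t = n^(1/(4D)). The value 1/2 for [n < 2] keeps it strictly between 0 and 1, so
    that the parameters are admissible for every [n]. *)
Definition scale (n : nat) : R :=
  if (n < 2)%N then 1 / 2 else n%:R `^ - (4 * D)%:R^-1.

Definition small_prob (n : nat) : R := scale n ^+ (4 * D).-1.
Definition cross_bias (n : nat) : R := scale n ^+ (2 * D).-2.

Lemma scale_pow n : (2 <= n)%N -> n%:R * scale n ^+ (4 * D) = 1.
Proof.
move=> n2; have n0 : 0 < n%:R :> R by rewrite ltr0n; lia.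
rewrite /scale ltnNge n2 /= -powR_mulrn ?powR_ge0 // -powRrM mulNr mulVf ?pnatr_eq0; last by lia.
by rewrite powR_inv1 ?ltW // mulfV // gt_eqF.
Qed.

Lemma scale_gt0 n : 0 < scale n.
Proof.
rewrite /scale; case: ifP => [_|n2]; first by lra.
by rewrite powR_gt0 // ltr0n; lia.
Qed.

Lemma scale_lt1 n : scale n < 1.
Proof.
have [n2|n2] := ltnP n 2; first by rewrite /scale n2; lra.
have := scale_pow n2; rewrite ltNge => e; apply/negP => s1.
have : 1 <= scale n ^+ (4 * D) by rewrite exprn_ege1.
have : 2 <= n%:R :> R by rewrite (ler_nat R 2).
move: (scale n ^+ (4 * D)) e => z e; nra.
Qed.

Lemma scale_eventually_le (c : R) : 0 < c ->
  exists N : nat, forall n, (N <= n)%N -> (2 <= n)%N -> scale n <= c.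
Proof.
(* Since [scale n ^+ (4 * D)] is 1/n, it is enough that [n] exceeds [c ^- (4 * D)]. *)
move=> c0; exists (Num.bound (c ^- (4 * D))).+1 => n nN n2.
have cD : 0 < c ^+ (4 * D) by rewrite exprn_gt0.
have [u0 c00 D0] : [/\ 0 <= scale n, 0 <= c & (0 < 4 * D)%N] by split; [exact: ltW (scale_gt0 n)|exact: ltW|lia].
rewrite -(ler_pXn2r D0) ?nnegrE //.
have n0 : 0 < n%:R :> R by rewrite ltr0n; lia.
rewrite -(ler_pM2l n0) scale_pow // -ler_pdivrMr // div1r.
have /archi_boundP h : 0 <= c ^- (4 * D) by rewrite invr_ge0 ltW.
apply: ltW; apply: lt_le_trans h _; rewrite ler_nat; lia.
Qed.

Lemma small_prob_gt0 n : 0 < small_prob n.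
Proof. by rewrite exprn_gt0 ?scale_gt0. Qed.

Lemma small_prob_le_scale n : small_prob n <= scale n.
Proof.
rewrite /small_prob -[X in _ <= X]expr1; apply: ler_wiXn2l; last by lia.
  by rewrite ltW ?scale_gt0.
by rewrite ltW ?scale_lt1.
Qed.

Lemma small_prob_lt1 n : small_prob n < 1.
Proof. exact: le_lt_trans (small_prob_le_scale n) (scale_lt1 n). Qed.

Lemma cross_bias_gt0 n : 0 < cross_bias n.
Proof. by rewrite exprn_gt0 ?scale_gt0. Qed.

Lemma cross_bias_le1 n : cross_bias n <= 1.
Proof. by rewrite exprn_ile1 // ltW ?scale_gt0 ?scale_lt1. Qed.

(** As [n] is the power -4D of [scale n], comparing such monomials amounts to comparing exponents,
    an arithmetic question in natural numbers. *)
Lemma scale_exponent_le n (a b c : nat) : (2 <= n)%N -> (4 * D * a + c <= b)%N ->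
  n%:R ^+ a * scale n ^+ b <= scale n ^+ c.
Proof.
move=> n2 abc; rewrite (_ : b = (4 * D * a + (b - 4 * D * a))%N); last by lia.
rewrite exprD exprM mulrA -exprMn scale_pow // expr1n mul1r.
by apply: ler_wiXn2l; rewrite ?ltW ?scale_gt0 ?scale_lt1 //; lia.
Qed.

Lemma scale_exponent_ge1 n (a b : nat) : (2 <= n)%N -> (b <= 4 * D * a)%N ->
  1 <= n%:R ^+ a * scale n ^+ b.
Proof.
move=> n2 ab; have s0 := scale_gt0 n; have s1 := scale_lt1 n.
rewrite [X in X <= _](_ : 1 = n%:R ^+ a * scale n ^+ (4 * D * a)); last first.
  by rewrite exprM -exprMn scale_pow // expr1n.
rewrite ler_wpM2l ?exprn_ge0 //.
by apply: ler_wiXn2l => //; rewrite ltW.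
Qed.

(** * Gap against standard deviation for the chosen parameters *)

Let P n := @sbm_pmf R n 2 (two_pmf (small_prob n)) (cross_mx (cross_bias n)).

Lemma sc_gap_le_scale (V : finType) (H : sgraph V) n :
  connected_graph H -> (1 <= #|edges H| <= D)%N -> ~ graph_iso H (star D) -> (2 <= n)%N ->
  sc_gap P H n ^+ 2 <=
  (2 ^+ #|V| * scale n) ^+ 2 * variance (@er_half_pmf R n) (@signed_count R V H n).
Proof.
move=> connH /andP[e1 eD] nstar n2.
have s0 := scale_gt0 n; have s1 := scale_lt1 n.
rewrite /sc_gap /P sc_gap_sbm ?small_prob_gt0 ?small_prob_lt1 ?cross_bias_gt0 //.
have := @sc_gap_le R (small_prob n) (cross_bias n) n (small_prob_gt0 n) (small_prob_lt1 n)
  (cross_bias_gt0 n) V H e1 D connH eD nstar.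
move/le_trans; apply; apply: ler_wpM2r.
  by apply: le_trans (variance_half_ge R n e1).
have -> : (2 ^+ #|V| * scale n) ^+ 2 = 4 ^+ #|V| * scale n ^+ 2.
  rewrite exprMn -exprM mulnC exprM; congr (_ ^+ _ * _). ring.
apply: ler_wpM2l; first by rewrite exprn_ge0.
have vE := connected_card_le connH.
apply: (@le_trans _ _ (n%:R ^+ #|edges H|.+1 * (cross_bias n ^+ (2 * #|edges H|) *
     small_prob n ^+ (2 * (if (#|edges H| < D)%N then 1 else 2))))).
  rewrite -mulrA ler_wpM2r //.
    by rewrite mulr_ge0 ?exprn_ge0 // ltW ?cross_bias_gt0 ?small_prob_gt0.
  by rewrite ler_weXn2l // ler1n; lia.
rewrite /cross_bias /small_prob -!exprM -exprD.
apply: scale_exponent_le => //.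
(* Writing e for the number of edges, the exponent inequality reduces to e + 1 <= D when e < D, and
   to 6 <= 8D when e = D. *)
case: ltnP => eD'; first by nia.
have -> : #|edges H| = D by lia.
nia.
Qed.

(** Both variances are at most a constant times n^(2D+2) [K], and the gap is at least a constant
    times n^(D+1) q d^D. The condition [2 * D < n] serves to count copies, and [scale n <= 1 / 2]
    keeps (1 - q)^D at least 2^(-D). *)
Lemma variance_le_gap : exists C : R, 0 < C /\ forall n, (2 * D < n)%N -> scale n <= 1 / 2 ->
  variance (@er_half_pmf R n) (@signed_count R _ (star D) n) <=
    C * scale n * sc_gap P (star D) n ^+ 2 /\
  variance (@P n) (@signed_count R _ (star D) n) <=
    C * scale n * sc_gap P (star D) n ^+ 2.
Proof.
pose c1 : R := 2 ^+ (2 * D.+1) * D.+2%:R ^+ D.+1.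
(* The three factors lost in the gap: falling factorial against power, maps per copy, and (1 -
   q)^D. *)
pose c2 : R := (2 ^+ D.+1 * D.+1%:R ^+ D.+1 * 2 ^+ D) ^+ 2.
exists (c1 * c2); split.
  by rewrite !(mulr_gt0, exprn_gt0) // ltr0n.
move=> n Dn shalf.
have n2 : (2 <= n)%N by lia.
have s0 := scale_gt0 n; have s1 := scale_lt1 n.
set q := small_prob n; set d := cross_bias n.
have q0 : 0 < q := small_prob_gt0 n.
have q1 : q < 1 := small_prob_lt1 n.
have d0 : 0 < d := cross_bias_gt0 n.
(* Up to a constant, [K] is [scale n] times the square of q d^D, so the ratio of variance to squared
   gap is of order [scale n]. *)
pose K : R := 2 ^+ (2 * D.+1) * (scale n * q ^+ 2 * d ^+ (2 * D)).
have hd : 1 <= n%:R * d ^+ 2.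
  rewrite -[n%:R]expr1 /d /cross_bias -exprM; apply: scale_exponent_ge1 => //; lia.
have p1 : 1 <= 2 ^+ (2 * D.+1) :> R by rewrite exprn_ege1 // ler1n.
have hK1 : 1 <= n%:R ^+ D.+1 * K.
  rewrite /K mulrCA mulr_ege1 //.
  rewrite /q /d /small_prob /cross_bias -!exprM -{1}[scale n]expr1 -!exprD.
  by apply: scale_exponent_ge1 => //; nia.
(* [scale n * q] is [scale n ^+ (4 * D)], that is 1/n, so the two sides in fact agree. *)
have hK2 : 2 ^+ (2 * D.+1) * q * d ^+ (2 * D) <= n%:R * K.
  rewrite /K (_ : n%:R * _ = 2 ^+ (2 * D.+1) * q * d ^+ (2 * D) * (n%:R * (scale n * q))); last by ring.
  rewrite ler_peMr //; first by rewrite !mulr_ge0 // ?exprn_ge0 // ltW.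
  rewrite /q /small_prob -exprS -[n%:R]expr1; apply: scale_exponent_ge1 => //; lia.
have D0 : (0 < D)%N by lia.
suff bound : n%:R ^+ D.+1 * (D.+2%:R * n%:R) ^+ D.+1 * K <=
    c1 * c2 * scale n * sc_gap P (star D) n ^+ 2.
  split; apply: le_trans bound.
    exact: (variance_half_star_le q0 q1 d0).
  exact: (variance_sbm_star_le q0 q1 d0).
have gapE : sc_gap P (star D) n =
    \sum_(S : {set 'I_n} * {set {set 'I_n}} | is_copy (star D) S)
      d ^+ #|S.2| * cross_prob q S.2.
  by rewrite /sc_gap /P sc_gap_sbm // card_edges_star.
have gap_ge := @sc_gap_star_ge R q d n q0 q1 d0 D.
rewrite -gapE in gap_ge.
set N := #|_| in gap_ge.
have Nge : n%:R ^+ D.+1 <= 2 ^+ D.+1 * D.+1%:R ^+ D.+1 * N%:R :> R.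
  have := card_copies_ge (star D) n; rewrite card_ord -/N => hN.
  (* For [i <= D] and [2 * D < n], every factor satisfies n <= 2(n - i). *)
  have hff : (n ^ D.+1 <= 2 ^ D.+1 * n ^_ D.+1)%N.
    have prodE k : (k ^ D.+1 = \prod_(i < D.+1) k)%N by rewrite prod_nat_const card_ord.
    rewrite ffact_prod !prodE -big_split /=.
    by apply: leq_prod => i _; have := ltn_ord i; lia.
  rewrite -!natrX -!natrM ler_nat (leq_trans hff) // -mulnA leq_mul2l.
  by rewrite [(_ * N)%N]mulnC hN orbT.
have qhalf : 1 <= 2 ^+ D * (1 - q) ^+ D.
  rewrite -exprMn exprn_ege1 //; have := small_prob_le_scale n; rewrite -/q; lra.
have q00 := ltW q0; have d00 := ltW d0; have s00 := ltW s0.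
have main : n%:R ^+ D.+1 * (q * d ^+ D) <=
    2 ^+ D.+1 * D.+1%:R ^+ D.+1 * 2 ^+ D * sc_gap P (star D) n.
  apply: (@le_trans _ _ (2 ^+ D.+1 * D.+1%:R ^+ D.+1 * N%:R * (q * d ^+ D))).
    by rewrite ler_wpM2r // mulr_ge0 ?exprn_ge0.
  rewrite -!mulrA !ler_wpM2l ?exprn_ge0 //.
  apply: (@le_trans _ _ (2 ^+ D * (N%:R * (q * (1 - q) ^+ D * d ^+ D)))); last first.
    by rewrite ler_wpM2l ?exprn_ge0.
  rewrite (_ : 2 ^+ D * _ = N%:R * (q * d ^+ D) * (2 ^+ D * (1 - q) ^+ D)); last by ring.
  by rewrite ler_peMr // !mulr_ge0 ?exprn_ge0.
have -> : n%:R ^+ D.+1 * (D.+2%:R * n%:R) ^+ D.+1 * K =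
    c1 * scale n * (n%:R ^+ D.+1 * (q * d ^+ D)) ^+ 2.
  have -> : K = 2 ^+ (2 * D.+1) * (scale n * q ^+ 2 * (d ^+ D) ^+ 2).
    by rewrite /K -exprM (mulnC D).
  rewrite /c1 exprMn; move: (2 ^+ _) (D.+2%:R ^+ _) (n%:R ^+ _) (d ^+ D) => x y z w.
  by ring.
rewrite [X in _ <= X](_ : _ = c1 * scale n *
   (2 ^+ D.+1 * D.+1%:R ^+ D.+1 * 2 ^+ D * sc_gap P (star D) n) ^+ 2); last first.
  by rewrite exprMn -/c2 [RHS]mulrA (mulrAC c1).
rewrite ler_wpM2l ?mulr_ge0 ?exprn_ge0 // lerXn2r // nnegrE.
  by rewrite !mulr_ge0 ?exprn_ge0.
by rewrite (le_trans _ main) // !mulr_ge0 ?exprn_ge0.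
Qed.

(** * From finite bounds to the asymptotic statements *)

Lemma littleo_eventually (f g : nat -> R) :
  (forall e : R, 0 < e -> exists N : nat, forall n, (N <= n)%N -> `|f n| <= e * `|g n|) ->
  (f =o_\oo g)%classic.
Proof.
move=> h; apply/eqoP => e e0; have [N hN] := h e e0.
by exists N => // n; apply: hN.
Qed.

Lemma star_distinguishes : sc_distinguishes P (star D).
Proof.
apply: littleo_eventually => e e0.
have [C [C0 hC]] := variance_le_gap.
(* Once [scale n] is below this threshold, C [scale n] is at most e^2, and taking square roots
   bounds both standard deviations by e times the gap. *)
have eC : 0 < e ^+ 2 / C by rewrite divr_gt0 ?exprn_gt0.
have [N1 h1] := scale_eventually_le eC.
have [N2 h2] := @scale_eventually_le (1 / 2) ltac:(lra).
exists (N1 + N2 + 2 * D).+1 => n nN.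
have [Vh Vp] := hC n ltac:(lia) (h2 n ltac:(lia) ltac:(lia)).
have sC : C * scale n <= e ^+ 2.
  by rewrite mulrC -ler_pdivlMr // h1 //; lia.
have g0 : 0 <= sc_gap P (star D) n by rewrite normr_ge0.
have sq v : v <= C * scale n * sc_gap P (star D) n ^+ 2 ->
    Num.sqrt v <= e * sc_gap P (star D) n.
  have eg0 : 0 <= e * sc_gap P (star D) n by rewrite mulr_ge0 // ltW.
  move=> hv; rewrite -(ger0_norm eg0) -sqrtr_sqr ler_wsqrtr //.
  by rewrite exprMn (le_trans hv) // ler_wpM2r ?exprn_ge0.
rewrite (ger0_norm g0) ger0_norm; last by rewrite le_max sqrtr_ge0.
by rewrite ge_max !sq.
Qed.

Lemma other_fails (V : finType) (H : sgraph V) :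
  connected_graph H -> (1 <= #|edges H| <= D)%N -> ~ graph_iso H (star D) -> sc_fails P H.
Proof.
move=> connH eH nstar; apply: littleo_eventually => e e0.
have v0 : 0 < 2 ^+ #|V| :> R by rewrite exprn_gt0.
have [N hN] := @scale_eventually_le (e / 2 ^+ #|V|) ltac:(by rewrite divr_gt0).
exists (N + 2)%N => n nN.
have n2 : (2 <= n)%N by lia.
have sn : 2 ^+ #|V| * scale n <= e by rewrite mulrC -ler_pdivlMr // hN //; lia.
have s0 := ltW (scale_gt0 n).
have g0 : 0 <= sc_gap P H n by rewrite normr_ge0.
have h := sc_gap_le_scale connH eH nstar n2.
rewrite (ger0_norm g0) [X in _ <= _ * X]ger0_norm; last by rewrite le_max sqrtr_ge0.
(* Of the two terms in the maximum, the unbiased standard deviation alone dominates the gap. *)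
apply: (@le_trans _ _ (e * Num.sqrt (variance (@er_half_pmf R n) (@signed_count R V H n)))); last first.
  by rewrite ler_wpM2l ?(ltW e0) // le_max lexx.
set v := variance _ _ in h *.
have v_ge0 : 0 <= v.
  by apply: le_trans (variance_half_ge R n _); case/andP: eH.
rewrite -(@ler_pXn2r _ 2) ?nnegrE ?mulr_ge0 ?sqrtr_ge0 ?(ltW e0) //.
rewrite exprMn sqr_sqrtr // (le_trans h) // ler_wpM2r //.
by rewrite lerXn2r ?nnegrE ?mulr_ge0 // ltW.
Qed.

End Asymptotics.

Unset Implicit Arguments.

Theorem theoremA5 (R : realType) (D : nat) (hD : (3 <= D)%N) :
  exists (p : nat -> 'rV[R]_2) (Q : nat -> 'M[R]_2),
    let P := fun n : nat => @sbm_pmf R n 2 (p n) (Q n) in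
    (forall n : nat, sbm_params (p n) (Q n)) /\
    sc_distinguishes P (star D) /\
    (forall (V : finType) (H : sgraph V),
        connected_graph H ->
        (1 <= #|edges H| <= D)%N ->
        ~ graph_iso H (star D) ->
        sc_fails P H).
Proof.
exists (fun n => two_pmf (small_prob R D n)), (fun n => cross_mx (cross_bias R D n)).
split.
  move=> n; apply: sbm_params_two; rewrite ?small_prob_gt0 ?small_prob_lt1 //.
  by rewrite ltW ?cross_bias_gt0 ?cross_bias_le1.
split; first exact: star_distinguishes.
by move=> V H; apply: other_fails.
Qed.
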